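(* Let $G=C_N$ be the cycle graph on $N$ nodes $\{0,1,\dots,n\}$, $n=N-1$, for an even $N>2$. Then there exists a choice of (nonzero, symmetric) coupling coefficients $K$ for which the algebraic Kuramoto system $\vec f_{(G,K,w\vec 1)}$ with homogeneous natural frequencies has infinitely many zeros in $(\mathbb{C}^* )^n$. Specifically, for a fixed $k\in\mathbb{C}^*$ and any choice of $k_{ij}\in\{\pm k\}$ (one per edge, $k_{ij}=k_{ji}$) with - an even number of negative choices (i.e. of edges with $k_{ij}=-k$) if $N\equiv0\bmod 4$, - an odd number of negative choices if $N\equiv2\bmod4$, the zero set in $(\mathbb{C}^* )^n$ of $\vec f_{(G,K,\vec 0)}$ is positive-dimensional and contains the image of the tree solution $\lambda\mapsto\mathbf{x}_{\vec T}(\lambda)$, $\lambda\in\mathbb{C}^*$, for any weak spanning tree $\vec T$ of any balanced orientation $\vec H$ of $C_N$. Moreover, if $k\in\mathbb{R}\setminus\{0\}$, the corresponding transcendental Kuramoto system has a positive-dimensional real zero set.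
   Context: For a connected graph $G$ on nodes $\{0,\dots,n\}$, coupling coefficients $k_{ij}=k_{ji}\neq0$ for $\{i,j\}\in\mathcal{E}(G)$ and natural frequencies $\vec w=(w_0,\dots,w_n)$, put $\overline w_i=w_i-\frac1{n+1}\sum_{j=0}^nw_j$, $a_{ij}=k_{ij}/(2\mathfrak{i})$, $x_0=1$. The algebraic Kuramoto system $\vec f_{(G,K,\vec w)}$ is $\overline w_i-\sum_{j\sim i}a_{ij}\left(\frac{x_i}{x_j}-\frac{x_j}{x_i}\right)$, $i=1,\dots,n$. The transcendental Kuramoto system is $\overline w_i-\sum_{j\sim i}k_{ij}\sin(\theta_i-\theta_j)$, $i=1,\dots,n$, in the real unknowns $\theta_1,\dots,\theta_n$ with $\theta_0=0$. Homogeneous natural frequencies $\vec w=w\vec 1$ (all $w_i$ equal) give $\overline w_i=0$ for all $i$. A balanced orientation $\vec H$ of $C_N$ is an orientation with equally many arcs pointing clockwise and counterclockwise. A weak spanning tree $\vec T$ of $\vec H$ is a subdigraph whose underlying graph is a spanning tree of $C_N$ (so $\vec T$ is $\vec H$ minus one arc). The reduced incidence matrix $\check Q(\vec T)\in\mathbb{Z}^{n\times n}$ has columns $\vec e_i-\vec e_j$ for arcs $(i,j)$ of $\vec T$, with $\vec e_0=\vec0$; it is unimodular. Let $\vec v_1=\vec e_p-\vec e_q$, where $(p,q)$ is the arc of $\vec H$ not in $\vec T$, and $\boldsymbol\tau_1=(\check Q(\vec T)^{-1}\vec v_1)^\top$. The tree solution is $$\mathbf{x}_{\vec T}(\lambda)=\big[\lambda\boldsymbol\tau_1\circ\mathbf{a}(\vec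 T)^{-I}\big]^{\check Q(\vec T)^{-1}},$$ where $\mathbf{a}(\vec T)$ is the row vector of the $a_{ij}$ over the arcs of $\vec T$ (ordered as the columns of $\check Q(\vec T)$), $\circ$ is the entrywise product, $\mathbf{a}^{-I}$ is the entrywise inverse, and for a matrix $A=[\vec a_1\cdots\vec a_m]$, $\mathbf{y}^A=(\mathbf{y}^{\vec a_1},\dots,\mathbf{y}^{\vec a_m})$ with $\mathbf{y}^{\vec a}=\prod_i y_i^{a_i}$. Equivalently $\mathbf{x}_{\vec T}(\lambda)$ is the unique point with $a_{ij}x_i/x_j=\lambda(\boldsymbol\tau_1)_{(i,j)}$ for every arc $(i,j)$ of $\vec T$. *)

(* Defs.v *)
(* mpoly is required without being imported: its notations clash with those of
   MathComp-Analysis. *)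
From HB Require Import structures.
From mathcomp Require Import all_boot all_order all_algebra.
From mathcomp Require Import all_classical all_reals all_analysis.
From mathcomp Require Export complex.
From mathcomp Require mpoly.
Set Implicit Arguments.
Unset Strict Implicit.
Unset Printing Implicit Defensive.
Import Order.TTheory GRing.Theory Num.Theory numFieldNormedType.Exports.
Local Open Scope classical_set_scope.
Local Open Scope ring_scope.

(* A simple graph on the nodes {0,..,n} is a symmetric irreflexive relation on
   'I_n.+1.  The unknowns indexed by 1,..,n form a row vector v : 'rV_n whose
   entry v 0 j belongs to the node lift ord0 j = j + 1; with_root c v is the
   family over all nodes in which node 0 has the value c. *)
Definition with_root (T : Type) (n : nat) (c : T) (v : 'rV[T]_n)
    (i : 'I_n.+1) : T :=
  if unlift ord0 i is Some j then v ord0 j else c.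

Definition coupling (F : fieldType) (n : nat) (e : rel 'I_n.+1)
    (K : 'M[F]_n.+1) : Prop :=
  forall i j, e i j -> K i j = K j i /\ K i j != 0.

Definition wbar (F : fieldType) (n : nat) (w : 'rV[F]_n.+1) (i : 'I_n.+1) : F :=
  w ord0 i - (n.+1)%:R^-1 * \sum_j w ord0 j.

Definition torus (F : fieldType) (n : nat) : set 'rV[F]_n :=
  [set x | forall j, x ord0 j != 0].

Section Kuramoto.
Variables (R : realType) (n : nat) (e : rel 'I_n.+1).

Definition acoef (K : 'M[R[i]]_n.+1) (i j : 'I_n.+1) : R[i] :=
  K i j / (2%:R * 'i%C).

Definition alg_kuramoto (K : 'M[R[i]]_n.+1) (w : 'rV[R[i]]_n.+1)
    (x : 'rV[R[i]]_n) (i : 'I_n.+1) : R[i] :=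
  let X := with_root 1 x in
  wbar w i - \sum_(j | e i j) acoef K i j * (X i / X j - X j / X i).

Definition alg_zeros (K : 'M[R[i]]_n.+1) (w : 'rV[R[i]]_n.+1) :
    set 'rV[R[i]]_n :=
  [set x | torus x /\ forall r : 'I_n, alg_kuramoto K w x (lift ord0 r) = 0].

Definition trans_kuramoto (K : 'M[R]_n.+1) (w : 'rV[R]_n.+1)
    (theta : 'rV[R]_n) (i : 'I_n.+1) : R :=
  let Theta := with_root 0 theta in
  wbar w i - \sum_(j | e i j) K i j * sin (Theta i - Theta j).

Definition trans_zeros (K : 'M[R]_n.+1) (w : 'rV[R]_n.+1) : set 'rV[R]_n :=
  [set theta | forall r : 'I_n, trans_kuramoto K w theta (lift ord0 r) = 0].

End Kuramoto.

Section Dimension.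
Variables (F : fieldType) (n : nat).

(* The closed subsets of the torus are the traces of those of affine space, so
   ordinary polynomials define the same topology as Laurent polynomials. *)
Definition zariski_closed (Z : set 'rV[F]_n) : Prop :=
  exists S : set (mpoly.mpoly n F),
    Z = [set x | torus x /\
                 forall p, S p -> mpoly.meval (fun j => x ord0 j) p = 0].

Definition zariski_irreducible (Z : set 'rV[F]_n) : Prop :=
  Z !=set0 /\
  forall A B, zariski_closed A -> zariski_closed B -> Z `<=` A `|` B ->
    Z `<=` A \/ Z `<=` B.

(* dim V >= d for a closed subset V of the torus, dim being the Krull
   dimension of V with its Zariski topology. *)
Definition krull_dim_ge (V : set 'rV[F]_n) (d : nat) : Prop :=
  exists Z : nat -> set 'rV[F]_n,
    (forall i, (i <= d)%N ->
       [/\ zariski_closed (Z i), zariski_irreducible (Z i) & Z i `<=` V]) /\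
    (forall i, (i < d)%N -> Z i `<` Z i.+1).

End Dimension.

Section RealDimension.
Variable R : realType.

Fixpoint Cn_on (k d n : nat) (U : set 'rV[R]_d) (f : 'rV[R]_d -> 'rV[R]_n) :
    Prop :=
  if k is k'.+1 then
    (forall x, U x -> differentiable f x) /\
    (forall v, Cn_on k' U (fun x => 'D_v f x))
  else forall x, U x -> {for x, continuous f}.

(* dim S >= d for a real analytic subset S of R^n: S contains a smooth
   submanifold of dimension d.  An injective immersion is an embedding after
   shrinking its domain, so no further topological condition is needed. *)
Definition real_dim_ge (n : nat) (S : set 'rV[R]_n) (d : nat) : Prop :=
  exists (U : set 'rV[R]_d) (f : 'rV[R]_d -> 'rV[R]_n),
    [/\ open U /\ U !=set0,
        forall k, Cn_on k U f,
        {in U &, injective f},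
        forall x, U x -> injective ('d f x)
      & f @` U `<=` S].

End RealDimension.

Section Digraph.
Variable n : nat.
Local Notation node := 'I_n.+1.
Local Notation arc := (node * node)%type.

(* i and j are adjacent in C_N, N = n + 1, when one is the successor of the
   other modulo N. *)
Definition cycle_adj : rel node := [rel i j | (j == ordS i) || (i == ordS j)].

Definition orientation (e : rel node) (H : {set arc}) : Prop :=
  (forall i j, (i, j) \in H -> e i j) /\
  (forall i j, e i j -> ((i, j) \in H) (+) ((j, i) \in H)).

Definition balanced_orientation (H : {set arc}) : Prop :=
  orientation cycle_adj H /\
  #|[set a in H | a.2 == ordS a.1]| = #|[set a in H | a.1 == ordS a.2]|.

Definition underlying (T : {set arc}) : rel node :=
  [rel i j | ((i, j) \in T) || ((j, i) \in T)].

(* Connected and acyclic.  A closed walk of length 2 through distinct nodes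
   just goes back and forth along an edge, hence size c <= 2. *)
Definition tree (e : rel node) : Prop :=
  (forall i j, connect e i j) /\
  (forall c : seq node, ucycle e c -> (size c <= 2)%N).

Definition weak_spanning_tree (H T : {set arc}) : Prop :=
  T \subset H /\ tree (underlying T).

Definition arc_vec (a : arc) : 'cV[int]_n :=
  \col_r ((a.1 == lift ord0 r)%:R - (a.2 == lift ord0 r)%:R).

(* t lists the arcs of the tree. *)
Definition rinc (t : n.-tuple arc) : 'M[int]_n :=
  \matrix_(r, c) arc_vec (tnth t c) r ord0.

Definition tau (t : n.-tuple arc) (a : arc) : 'rV[int]_n :=
  (invmx (rinc t) *m arc_vec a)^T.

Definition mx_power (F : fieldType) (y : 'rV[F]_n) (A : 'M[int]_n) : 'rV[F]_n :=
  \row_c \prod_r (y ord0 r) ^ (A r c).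

(* a is the arc of the orientation that does not occur in t. *)
Definition tree_solution (R : realType) (K : 'M[R[i]]_n.+1)
    (t : n.-tuple arc) (a : arc) (lambda : R[i]) : 'rV[R[i]]_n :=
  mx_power
    (\row_c (lambda * (tau t a ord0 c)%:~R *
             (acoef K (tnth t c).1 (tnth t c).2)^-1))
    (invmx (rinc t)).

(* Symmetric couplings k or - k on the edges of C_N; an unordered edge {i, j}
   is counted once, as the pair (i, j) with i < j. *)
Definition sign_choice (F : fieldType) (k : F) (K : 'M[F]_n.+1) : Prop :=
  forall i j, cycle_adj i j -> K i j = K j i /\ (K i j = k \/ K i j = - k).

Definition num_negative (F : fieldType) (k : F) (K : 'M[F]_n.+1) : nat :=
  #|[pred a : arc | [&& (a.1 < a.2)%N, cycle_adj a.1 a.2 & K a.1 a.2 == - k]]|.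

Definition parity_condition (m : nat) : Prop :=
  ((n.+1 %% 4 = 0)%N -> ~~ odd m) /\ ((n.+1 %% 4 = 2)%N -> odd m).

End Digraph.

(* Main.v *)
Require Import Defs.
From HB Require Import structures.
From mathcomp Require Import all_boot all_order all_algebra.
From mathcomp Require Import all_classical all_reals all_analysis.
From mathcomp Require Import zify ring.
(* Without the notations of mpoly, which clash with those of the analysis. *)
From mathcomp Require mpoly.
Import (canonicals) mpoly.
Import Order.TTheory GRing.Theory Num.Theory numFieldNormedType.Exports.
Local Open Scope classical_set_scope.
Local Open Scope ring_scope.

(** For w homogeneous the system says that the signed flow
    a_i (X_i / X_(i+1) - X_(i+1) / X_i) through the edge from i to i+1 is the
    same for all i ([alg_zeros_of_flow]).  With b = k / (2 'i) every coefficient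
    a_i is b or -b, so for mu != 0 the flow is mu - b^2 / mu as soon as every
    a_i X_i / X_(i+1) is mu or -b^2 / mu.  The ratios X_i / X_(i+1) have to
    multiply to 1.  If each of the two values occurs N/2 times, the values
    multiply to (-1)^(N/2) b^N, whereas the a_i multiply to b^N times the sign
    (-1)^(number of negative couplings): the parity condition says precisely that
    these agree, for all mu at once.

    Positive dimension.  Letting the two values alternate around the cycle gives
    the points X_i = (-1)^(m i) z^(odd i), where the signs m are provided by the
    parity condition ([sign_potential]).  As z varies they form a punctured
    line in the torus.  It is closed, being cut out by affine equations
    ([affine_zariski_closed]), and irreducible, being parametrized by polynomials
    ([poly_curve_irreducible]); with one of its points it is a chain of
    length 1.  In the real case the same signs give the straight line
    of angles t odd(i) + pi m(i), because sin (x + pi) = - sin x.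

    Tree solutions.  The reduced incidence matrix Q of a spanning tree is
    invertible over the integers ([rinc_unitmx]), so the exponents Q^-1 and Q
    cancel and the tree solution satisfies a_c X_p / X_q = lambda tau_c on the
    tree arcs c = (p, q) ([tree_solution_arc]).  The arcs of H, with sign 1 if
    clockwise and -1 otherwise, sum to zero, which gives tau ([tau_sign]) and
    shows that every edge of the tree carries the value mu or -b^2 / mu according
    to its direction.  The value on the remaining edge is then forced by the
    product formula of the first paragraph. *)

(** * Cycles, signs and parity *)

Lemma val_ordS {n : nat} (i : 'I_n.+1) :
  ordS i = (if i == n :> nat then 0 else i.+1)%N :> nat.
Proof.
have := ltn_ord i; rewrite /=; case: eqP => [->|ne] h; first by rewrite modnn.
rewrite modn_small //; lia.
Qed.

Lemma odd_ordS {n : nat} (i : 'I_n.+1) : ~~ odd n.+1 -> odd (ordS i) = ~~ odd i.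
Proof. by rewrite val_ordS; case: eqP => [->|//] /=; case: odd. Qed.

Lemma ordSS_neq {n : nat} (i : 'I_n.+1) : (2 < n.+1)%N -> ordS (ordS i) != i.
Proof.
move=> hN; apply/eqP => /(congr1 (@nat_of_ord _)).
by rewrite (val_ordS (ordS i)) (val_ordS i); have := ltn_ord i; do ?case: eqP; lia.
Qed.

Lemma cycle_adjS {n : nat} (i : 'I_n.+1) : cycle_adj i (ordS i).
Proof. by rewrite /cycle_adj /= eqxx. Qed.

Lemma cycle_adjSr {n : nat} (i : 'I_n.+1) : cycle_adj (ordS i) i.
Proof. by rewrite /cycle_adj /= eqxx orbT. Qed.

Lemma sum_cycle_neighbours (V : nmodType) (n : nat) (i : 'I_n.+1)
    (g : 'I_n.+1 -> V) : (2 < n.+1)%N ->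
  \sum_(j | cycle_adj i j) g j = g (ordS i) + g (ord_pred i).
Proof.
move=> hN; rewrite (bigD1 (ordS i)) /=; last exact: cycle_adjS.
rewrite (big_pred1 (ord_pred i)) // => j; rewrite /cycle_adj /=.
rewrite -[RHS](inj_eq (@ordS_inj n.+1)) ord_predK (eq_sym i).
case: (eqVneq (ordS j) i) => [<-|_]; last by rewrite orbF andbN.
by rewrite orbT eq_sym ordSS_neq.
Qed.

(** Kirchhoff's law on a cycle: an antisymmetric edge function that takes the
    same value on every clockwise arc is divergence free. *)
Lemma constant_flow_balance (V : zmodType) (n : nat)
    (g : 'I_n.+1 -> 'I_n.+1 -> V) (c : V) : (2 < n.+1)%N ->
  (forall i, g i (ordS i) = c) ->
  (forall i, g (ordS i) i = - g i (ordS i)) ->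
  forall i, \sum_(j | cycle_adj i j) g i j = 0.
Proof.
move=> hN gc gN i; rewrite sum_cycle_neighbours // gc.
by rewrite -{1}(ord_predK i) gN gc subrr.
Qed.

(** Counting the negative edges by their clockwise starting points. *)
Lemma num_negativeE (F : fieldType) (n : nat) (k : F) (K : 'M[F]_n.+1) :
  (2 < n.+1)%N -> sign_choice k K ->
  num_negative k K = #|[pred i | K i (ordS i) == - k]|.
Proof.
move=> hN hK.
(* the increasing pair of the edge between i and its successor *)
pose g (i : 'I_n.+1) := if (i < n)%N then (i, ordS i) else (ordS i, i).
have g_inj : injective g.
  move=> i j; rewrite /g.
  case: ltnP => hi; case: ltnP => hj [] //
    /(congr1 (@nat_of_ord _)) + /(congr1 (@nat_of_ord _)).
    by rewrite !val_ordS; do ?case: eqP; lia.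
  by rewrite !val_ordS; do ?case: eqP; lia.
rewrite -(card_imset _ g_inj) /num_negative; apply: eq_card => -[x y].
rewrite inE /=; apply/idP/imsetP => [/and3P[xy /orP[] /eqP h /eqP Kk]|].
- have xn : (x < n)%N by have := ltn_ord y; lia.
  by exists x; rewrite /g ?xn -?h // inE -h Kk.
- have yn : (y < n)%N = false.
    by move: xy; rewrite h val_ordS; case: eqP; lia.
  exists y; rewrite /g ?yn -?h // inE.
  by rewrite -(hK _ _ (cycle_adjSr y)).1 -h Kk.
- case=> i; rewrite inE /g => /eqP Kk.
  have hi := ltn_ord i; have hn := val_ordS i.
  case: ltnP => hin [-> ->]; rewrite ?cycle_adjS ?cycle_adjSr.
    by rewrite Kk eqxx andbT hn; case: eqP; lia.
  by rewrite -(hK _ _ (cycle_adjS i)).1 Kk eqxx andbT hn; case: eqP; lia.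
Qed.

(** The parity condition makes the cochain neg i + i (mod 2) on the edges of the
    cycle a coboundary. *)
Lemma sign_potential (n : nat) (neg : pred 'I_n.+1) :
  ~~ odd n.+1 -> parity_condition n #|neg| ->
  exists m : 'I_n.+1 -> bool,
    m ord0 = false /\ forall i, m (ordS i) = m i (+) neg i (+) odd i.
Proof.
move=> hev [h0 h2].
(* the parity of the sum of the integers below i is that of i./2 *)
pose M i := odd (\sum_(j < i) neg (inord j)) (+) odd i./2.
have MS i : M i.+1 = M i (+) neg (inord i) (+) odd i.
  rewrite /M big_ord_recr /= !oddD uphalf_half oddD !oddb.
  by case: (odd _); case: (neg _); case: (odd i); case: (odd _).
have MN : M n.+1 = false.
  rewrite /M (_ : (\sum_(j < n.+1) _)%N = #|neg|); last first.
    rewrite -sum1_card [RHS]big_mkcond /=; apply: eq_bigr => i _.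
    by rewrite inord_val unfold_in; case: (neg i).
  have [e|e] : (n.+1 %% 4 = 0 \/ n.+1 %% 4 = 2)%N by lia.
    by have := h0 e; lia.
  by have := h2 e; lia.
exists (fun i => M i); split; first by rewrite /M big_ord0.
move=> i; rewrite val_ordS -[in neg i](inord_val i) -MS.
by case: eqP => [->|//]; rewrite MN /M big_ord0.
Qed.

Lemma with_root0 (T : Type) (n : nat) (c : T) (v : 'rV[T]_n) :
  with_root c v ord0 = c.
Proof. by rewrite /with_root unlift_none. Qed.

Lemma with_root_lift (T : Type) (n : nat) (c : T) (v : 'rV[T]_n) (j : 'I_n) :
  with_root c v (lift ord0 j) = v ord0 j.
Proof. by rewrite /with_root liftK. Qed.

Lemma with_root_row (T : Type) (n : nat) (X : 'I_n.+1 -> T) (i : 'I_n.+1) :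
  with_root (X ord0) (\row_j X (lift ord0 j)) i = X i.
Proof.
by case: (unliftP ord0 i) => [j ->|->]; rewrite ?with_root0 ?with_root_lift ?mxE.
Qed.

Lemma wbar_const (F : numFieldType) (n : nat) (w : F) (i : 'I_n.+1) :
  wbar (const_mx w) i = 0.
Proof.
rewrite /wbar mxE (eq_bigr (fun=> w)) => [|j _]; last by rewrite mxE.
by rewrite sumr_const card_ord -[w *+ _]mulr_natl mulKf ?subrr // pnatr_eq0.
Qed.

Lemma wbar0 (F : numFieldType) (n : nat) (i : 'I_n.+1) :
  wbar (0 : 'rV[F]_n.+1) i = 0.
Proof. by rewrite /wbar mxE big1 ?mulr0 ?subr0 // => j _; rewrite mxE. Qed.

Lemma prodr_sign (A : pzRingType) (I : finType) (P : pred I) :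
  \prod_i (-1) ^+ P i = (-1) ^+ #|P| :> A.
Proof.
by rewrite prodrXr -sum1_card [in RHS]big_mkcond.
Qed.

(** * Curves in the torus and Krull dimension *)

Lemma poly_nonzero_eval (F : numFieldType) (p : {poly F}) :
  p != 0 -> exists2 z, z != 0 & p.[z] != 0.
Proof.
move=> p0; apply: contrapT => H.
have /(max_poly_roots p0) : all (root p) [seq i.+1%:R | i <- iota 0 (size p)].
  apply/allP => _ /mapP[i _ ->]; apply/negP => /negP nr.
  by apply: H; exists i.+1%:R; rewrite // pnatr_eq0.
rewrite size_map size_iota ltnn => h; suff: false by []; apply: h.
rewrite map_inj_uniq ?iota_uniq // => i j /eqP.
by rewrite eqr_nat eqSS => /eqP.
Qed.

(** The image of the punctured line under a polynomial map is irreducible. *)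
Lemma poly_curve_irreducible (F : numFieldType) (n : nat)
    (P : 'I_n -> {poly F}) :
  zariski_irreducible [set \row_j (P j).[z] | z in [set z : F | z != 0]].
Proof.
pose phi z : 'rV[F]_n := \row_j (P j).[z].
split; first by exists (phi 1), 1 => //=; exact: oner_neq0.
(* the pull back of a polynomial along the curve *)
have pullback (p : mpoly.mpoly n F) :
    exists q : {poly F}, forall z, q.[z] = mpoly.meval (fun j => phi z ord0 j) p.
  exists (\sum_(m <- mpoly.msupp p) (mpoly.mcoeff m p)%:P *
    \prod_i P i ^+ mpoly.fun_of_multinom m i) => z.
  rewrite mpoly.mevalE horner_sum; apply: eq_bigr => m _.
  rewrite hornerM hornerC horner_prod; congr (_ * _); apply: eq_bigr => i _.
  by rewrite horner_exp mxE.
(* if neither closed set contains the curve, each has an equation that pulls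
   back to a nonzero polynomial, and the product of the two has a nonroot *)
move=> _ _ [SA ->] [SB ->] cover; apply: contrapT => /not_orP[nA nB].
have separate S : ~ ([set \row_j (P j).[z] | z in [set z : F | z != 0]] `<=`
      [set x | torus x /\ forall p, S p ->
        mpoly.meval (fun j => x ord0 j) p = 0]) ->
    exists2 q : {poly F}, q != 0 & forall z, z != 0 ->
      (forall p, S p -> mpoly.meval (fun j => phi z ord0 j) p = 0) -> q.[z] = 0.
  move=> nS; apply: contrapT => H; apply: nS => _ [z z0 <-]; split.
    by case: (cover (phi z)) => [|[]//|[]//]; exists z.
  move=> p Sp; have [q qE] := pullback p.
  rewrite -qE; have [->|q0] := eqVneq q 0; first by rewrite horner0.
  by case: H; exists q => // y _ /(_ p Sp); rewrite qE.
have [qA qA0 hA] := separate _ nA; have [qB qB0 hB] := separate _ nB.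
have [|z z0] := @poly_nonzero_eval _ (qA * qB); first by rewrite mulf_neq0.
rewrite hornerM mulf_eq0 => /norP[zA zB].
case: (cover (phi z)) => [|[_ /(hA _ z0) e]|[_ /(hB _ z0) e]]; first by exists z.
  by rewrite e eqxx in zA.
by rewrite e eqxx in zB.
Qed.

Lemma affine_zariski_closed (F : fieldType) (n : nat) (l : 'I_n)
    (b c : 'I_n -> F) :
  zariski_closed [set x : 'rV[F]_n | torus x /\
    forall j, x ord0 j = b j * x ord0 l + c j].
Proof.
pose q j : mpoly.mpoly n F :=
  mpoly.mpolyX F (mpoly.mnm1 j) -
  (b j *: mpoly.mpolyX F (mpoly.mnm1 l) + mpoly.mpolyC n (c j)).
have qE (x : 'rV[F]_n) j : mpoly.meval (fun j => x ord0 j) (q j) =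
    x ord0 j - (b j * x ord0 l + c j).
  by rewrite mpoly.mevalB mpoly.mevalD mpoly.mevalZ !mpoly.mevalXU mpoly.mevalC.
exists [set q j | j in [set: 'I_n]].
apply/seteqP; split => x /= [xt h]; split => //.
  by move=> _ [j _ <-]; rewrite qE h subrr.
by move=> j; apply/eqP; rewrite -subr_eq0 -qE h //; exists j.
Qed.

(** * The alternating curve *)

Section AlternatingCurve.
Variables (F : numFieldType) (n : nat) (m : 'I_n.+1 -> bool).

(** The nodes with odd label carry the parameter, all nodes carry a sign. *)
Definition alternating (z : F) (i : 'I_n.+1) : F := (-1) ^+ m i * z ^+ odd i.

(** The coordinates of [alternating] at the nodes other than node 0. *)
Definition alternating_point (z : F) : 'rV[F]_n :=
  \row_j alternating z (lift ord0 j).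

Lemma alternating_neq0 (z : F) i : z != 0 -> alternating z i != 0.
Proof. by move=> z0; rewrite mulf_neq0 ?signr_eq0 ?expf_neq0. Qed.

Lemma alternating_torus (z : F) : z != 0 -> torus (alternating_point z).
Proof. by move=> z0 j; rewrite mxE alternating_neq0. Qed.

Lemma alternating_inj : (0 < n)%N -> injective alternating_point.
Proof.
move=> n0 y z /rowP /(_ (Ordinal n0)); rewrite !mxE /alternating /=.
by rewrite !expr1 => /(mulfI _); apply; rewrite signr_eq0.
Qed.

Lemma alternating_krull_dim (V : set 'rV[F]_n) : (0 < n)%N ->
  (forall z, z != 0 -> V (alternating_point z)) -> krull_dim_ge V 1.
Proof.
move=> n0 HV; pose l := Ordinal n0.
pose P j : {poly F} :=
  (-1) ^+ m (lift ord0 j) *: (if odd (lift ord0 j) then 'X else 1).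
have PE z : \row_j (P j).[z] = alternating_point z.
  apply/rowP => j; rewrite !mxE /P /alternating hornerZ.
  by case: odd; rewrite ?hornerX ?hornerC ?expr1 ?expr0.
pose line := [set alternating_point z | z in [set z : F | z != 0]].
pose point := [set alternating_point 1].
have line_irr : zariski_irreducible line.
  rewrite (_ : line = [set \row_j (P j).[z] | z in [set z : F | z != 0]]).
    exact: poly_curve_irreducible.
  by apply: eq_imagel => z _; rewrite PE.
have point_irr : zariski_irreducible point.
  rewrite (_ : point = [set \row_j ((P j).[1]%:P).[z] | z in
    [set z : F | z != 0]]); first exact: poly_curve_irreducible.
  have cE z : \row_j ((P j).[1]%:P).[z] = alternating_point 1.
    by rewrite -PE; apply/rowP => j; rewrite !mxE hornerC.
  apply/seteqP; split => x /=; last by case=> z _ <-; rewrite cE.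
  by move=> ->; exists 1; rewrite ?cE //; exact: oner_neq0.
have line_closed : zariski_closed line.
  (* z is read off from the coordinate of node 1, up to sign *)
  pose b j : F := if odd (lift ord0 j) then
    (-1) ^+ m (lift ord0 j) * (-1) ^+ m (lift ord0 l) else 0.
  pose c j : F := if odd (lift ord0 j) then 0 else (-1) ^+ m (lift ord0 j).
  have := affine_zariski_closed F n l b c; congr zariski_closed.
  apply/seteqP; split => [x [xt h]|_ [z z0 <-]] /=.
    exists ((-1) ^+ m (lift ord0 l) * x ord0 l).
      by rewrite /= mulf_neq0 ?signr_eq0.
    apply/rowP => j; rewrite (h j) mxE /alternating /b /c.
    by case: odd; rewrite ?expr1 ?expr0 ?mul0r ?add0r ?addr0 ?mulr1 // mulrA.
  split=> [|j]; first exact: alternating_torus.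
  rewrite !mxE /alternating /b /c /= expr1.
  case: odd; rewrite ?expr1 ?expr0 ?mul0r ?add0r ?addr0 ?mulr1 //.
  by rewrite !mulrA -[_ * _ * (-1) ^+ _]mulrA -signr_addb addbb mulr1.
have point_closed : zariski_closed point.
  have := affine_zariski_closed F n l (fun=> 0) (fun j => alternating 1 (lift ord0 j)).
  congr zariski_closed; apply/seteqP; split => [x [xt h]|_ ->] /=.
    by apply/rowP => j; rewrite h mul0r add0r mxE.
  split=> [|j]; first by apply: alternating_torus; exact: oner_neq0.
  by rewrite mul0r add0r mxE.
exists (fun i => if i is 0%N then point else line); split=> [[|i]|[|i]] // _.
- split=> // _ ->; apply: HV; exact: oner_neq0.
- by split=> // _ [z z0 <-]; exact: HV.
- split=> [_ ->|/(_ (alternating_point 2%:R))]; first by exists 1; rewrite //= oner_neq0.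
  have h2 : line (alternating_point 2%:R) by exists 2%:R; rewrite //= pnatr_eq0.
  by move=> /(_ h2) /(alternating_inj n0) /eqP; rewrite (eqr_nat _ 2 1).
Qed.

Lemma alternating_infinite (V : set 'rV[F]_n) : (0 < n)%N ->
  (forall z, z != 0 -> V (alternating_point z)) -> infinite_set V.
Proof.
move=> n0 HV; apply/infiniteP; pose f k := alternating_point k.+1%:R.
have -> : [set: nat] = f @^-1` V.
  by apply/seteqP; split => k // _; apply: HV; rewrite pnatr_eq0.
apply: card_ge_preimage => i j _ _ /(alternating_inj n0) /eqP.
by rewrite eqr_nat eqSS => /eqP.
Qed.

End AlternatingCurve.

(** * The algebraic system *)

(** The sign of the edge is recovered from K by comparison with - k. *)
Lemma sign_choiceE (F : numFieldType) (n : nat) (k : F) (K : 'M[F]_n.+1) i :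
  sign_choice k K -> K i (ordS i) = (-1) ^+ (K i (ordS i) == - k) * k.
Proof.
move=> hK; have [_] := hK _ _ (cycle_adjS i).
case: eqP => [-> _|ne [->|]//]; first by rewrite expr1 mulN1r.
by rewrite expr0 mul1r.
Qed.

Lemma imaginary2_neq0 (R : realType) : 2%:R * 'i%C != 0 :> R[i].
Proof.
rewrite mulf_neq0 ?pnatr_eq0 //.
by apply/eqP => /(congr1 (@complex.Im R)) /eqP; rewrite /= oner_eq0.
Qed.

Section Algebraic.
Variables (R : realType) (n : nat).
Hypothesis hN : (2 < n.+1)%N.
Implicit Types (K : 'M[R[i]]_n.+1) (w : 'rV[R[i]]_n.+1) (k : R[i]).

(** A point of the torus is a zero of the homogeneous system as soon as all
    edges carry the same clockwise flow. *)
Lemma alg_zeros_of_flow K w (x : 'rV[R[i]]_n) (c : R[i]) :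
  (forall i, wbar w i = 0) ->
  (forall i j, cycle_adj i j -> K i j = K j i) ->
  torus x ->
  (forall i, acoef K i (ordS i) *
     (with_root 1 x i / with_root 1 x (ordS i) -
      with_root 1 x (ordS i) / with_root 1 x i) = c) ->
  alg_zeros (@cycle_adj n) K w x.
Proof.
move=> hw Ksym xt flow; split=> // r; rewrite /alg_kuramoto hw sub0r.
pose X := with_root 1 x.
pose g i j := acoef K i j * (X i / X j - X j / X i).
rewrite (@constant_flow_balance _ _ g c) ?oppr0 // => i.
by rewrite /g /acoef (Ksym _ _ (cycle_adjSr i)); ring.
Qed.

Lemma alternating_alg_zero k K w (m : 'I_n.+1 -> bool) (z : R[i]) :
  ~~ odd n.+1 -> sign_choice k K -> (forall i, wbar w i = 0) ->
  m ord0 = false ->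
  (forall i, m (ordS i) = m i (+) (K i (ordS i) == - k) (+) odd i) ->
  z != 0 -> alg_zeros (@cycle_adj n) K w (alternating_point _ _ m z).
Proof.
move=> hev hK hw m0 mS z0.
have root i : with_root 1 (alternating_point R[i] n m z) i = alternating _ _ m z i.
  have <- : alternating R[i] n m z ord0 = 1 by rewrite /alternating m0 expr0 mulr1.
  exact: with_root_row.
apply: (@alg_zeros_of_flow _ _ _ (k / (2%:R * 'i%C) * (z^-1 - z))) => //.
- by move=> i j /hK[].
- exact: alternating_torus.
move=> i; rewrite !root /acoef (sign_choiceE _ _ _ _ i hK) /alternating odd_ordS //.
rewrite mS; move: (imaginary2_neq0 R); move: (2%:R * _) => u u0.
by case: (m i); case: (_ == _); case: (odd i); rewrite /= !(expr0, expr1); field;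
  rewrite ?z0 ?u0.
Qed.

End Algebraic.

(** * The transcendental system *)

Section RealLine.
Variables (R : realType) (n : nat).
Implicit Types (c w : 'rV[R]_n).

(** The line through c with direction w, parametrized by a vector of length 1. *)
Definition real_line c w (x : 'rV[R]_1) : 'rV[R]_n := c + x ord0 ord0 *: w.

Lemma differentiable_real_line c w x : differentiable (real_line c w) x.
Proof.
apply: differentiableD => //.
exact: differentiableZl (differentiable_coord _ _ _).
Qed.

Lemma derive_real_line c w x v :
  'D_v (real_line c w) x = v ord0 ord0 *: w.
Proof.
rewrite /derive; apply: lim_near_cst => //.
near=> h; have h0 : h != 0 by near: h; exact: nbhs_dnbhs_neq.
rewrite /real_line /= opprD addrACA subrr add0r -scalerBl !mxE.
by rewrite addrK scalerA mulKf.
Unshelve. all: by end_near. Qed.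

(** A line is smooth: its directional derivatives are constant maps, that is
    lines with direction 0, so that induction on k applies. *)
Lemma Cn_on_real_line k (U : set 'rV[R]_1) c w : Cn_on k U (real_line c w).
Proof.
elim: k c w => [|k IH] c w /=.
  by move=> x _; apply: differentiable_continuous (differentiable_real_line _ _ _).
split=> [x _|v]; first exact: differentiable_real_line.
rewrite (_ : (fun x => _) = real_line (v ord0 ord0 *: w) 0); first exact: IH.
by apply/funext => x; rewrite derive_real_line /real_line scaler0 addr0.
Qed.

Lemma real_line_inj c w : w != 0 -> injective (real_line c w).
Proof.
move=> w0 x y /addrI /eqP; rewrite -subr_eq0 -scalerBl scaler_eq0 (negbTE w0).
by rewrite orbF subr_eq0 => /eqP e; apply/rowP => j; rewrite ord1.
Qed.

Lemma real_dim_line (S : set 'rV[R]_n) c w : w != 0 ->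
  (forall x, S (real_line c w x)) -> real_dim_ge S 1.
Proof.
move=> w0 HS; exists setT, (real_line c w); split.
- by split; [exact: openT | exists 0].
- by move=> k; exact: Cn_on_real_line.
- by move=> x y _ _; exact: real_line_inj.
- move=> x _ u v; have dx := differentiable_real_line c w x.
  rewrite -!(deriveE _ dx) !derive_real_line => e.
  by apply: (@real_line_inj 0 _ w0); rewrite /real_line e.
- by move=> _ [x _ <-]; exact: HS.
Qed.

End RealLine.

Lemma sin_natpi (R : realType) (m : nat) (x : R) :
  sin (x + pi *+ m) = (-1) ^+ m * sin x.
Proof.
elim: m => [|m IH]; first by rewrite mulr0n addr0 expr0 mul1r.
by rewrite mulrSr addrA sinDpi IH exprS mulN1r mulNr.
Qed.

Lemma sinB_natpi (R : realType) (m : nat) (x : R) :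
  sin (x - pi *+ m) = (-1) ^+ m * sin x.
Proof. by rewrite -{2}[x](subrK (pi *+ m)) sin_natpi signrMK. Qed.

Lemma alternating_trans_zero (R : realType) (n : nat) (k : R) (K : 'M[R]_n.+1)
    (w : 'rV[R]_n.+1) (m : 'I_n.+1 -> bool) (t : R) :
  (2 < n.+1)%N -> ~~ odd n.+1 -> sign_choice k K ->
  (forall i, wbar w i = 0) -> m ord0 = false ->
  (forall i, m (ordS i) = m i (+) (K i (ordS i) == - k) (+) odd i) ->
  trans_zeros (@cycle_adj n) K w
    (\row_j (t *+ odd (lift ord0 j) + pi *+ m (lift ord0 j))).
Proof.
move=> hN hev hK hw m0 mS r.
pose X (i : 'I_n.+1) : R := t *+ odd i + pi *+ m i.
have X0 : X ord0 = 0 by rewrite /X m0 addr0.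
rewrite /trans_kuramoto hw sub0r.
under eq_bigr => j _ do rewrite -X0 !with_root_row.
pose g i j := K i j * sin (X i - X j).
rewrite (@constant_flow_balance _ _ g (- (k * sin t))) ?oppr0 // => i.
  rewrite /g (sign_choiceE _ _ _ _ i hK) /X odd_ordS // mS.
  rewrite (_ : _ - _ = t *+ odd i - t *+ ~~ odd i + pi *+ m i -
    pi *+ (m i (+) (K i (ordS i) == - k) (+) odd i)); last by rewrite opprD addrACA addrA.
  rewrite sinB_natpi sin_natpi.
  by case: (m i); case: (_ == _); case: (odd i);
    rewrite /= !(expr0, expr1) ?subr0 ?sub0r ?sinN; ring.
by rewrite /g (hK _ _ (cycle_adjS i)).1 -opprB sinN mulrN.
Qed.

(** * Monomial maps and incidence matrices *)

Section MonomialMaps.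
Variables (F : fieldType) (n : nat).
Implicit Types (x y : 'rV[F]_n) (A B : 'M[int]_n).

Lemma mx_power_torus y A : torus y -> torus (mx_power y A).
Proof.
by move=> yt j; rewrite mxE; apply/prodf_neq0 => i _; rewrite expfz_neq0.
Qed.

Lemma mx_power1 y : mx_power y 1%:M = y.
Proof.
apply/rowP => j; rewrite mxE (bigD1 j) //= mxE eqxx expr1z big1 ?mulr1 //.
by move=> i /negbTE ij; rewrite mxE ij expr0z.
Qed.

Lemma mx_powerM y A B : torus y ->
  mx_power (mx_power y A) B = mx_power y (A *m B).
Proof.
move=> yt; apply/rowP => j; rewrite !mxE.
transitivity (\prod_r \prod_s y ord0 s ^ (A s r * B r j)).
  apply: eq_bigr => r _; rewrite mxE.
  rewrite (big_morph (fun z => z ^ B r j) (fun u v => expfzMl u v _) (exp1rz _ _)).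
  by apply: eq_bigr => s _; rewrite exprz_exp.
rewrite exchange_big; apply: eq_bigr => s _; rewrite mxE.
by rewrite (big_morph _ (fun u v => expfzDr u v (yt s)) (expr0z _)).
Qed.

Lemma node_monomial x (i : 'I_n.+1) :
  \prod_r x ord0 r ^ ((i == lift ord0 r)%:R : int) = with_root 1 x i.
Proof.
case: (unliftP ord0 i) => [j ->|->]; rewrite ?with_root_lift ?with_root0.
  rewrite (bigD1 j) //= eqxx expr1z big1 ?mulr1 // => r rj.
  by rewrite (inj_eq lift_inj) eq_sym (negbTE rj) expr0z.
by rewrite big1 // => r _; rewrite (negbTE (neq_lift _ _)) expr0z.
Qed.

Lemma arc_monomial x (a : 'I_n.+1 * 'I_n.+1) : torus x ->
  \prod_r x ord0 r ^ arc_vec a r ord0 =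
    with_root 1 x a.1 / with_root 1 x a.2.
Proof.
move=> xt; rewrite -!node_monomial -prodfV -big_split; apply: eq_bigr => r _.
by rewrite mxE expfzDr // invr_expz.
Qed.

End MonomialMaps.

(** The reduced incidence matrix of a spanning tree is unimodular: following a
    path of the tree from node 0 writes every basis vector as an integral
    combination of columns. *)
Lemma rinc_unitmx (n : nat) (T : {set 'I_n.+1 * 'I_n.+1})
    (t : n.-tuple ('I_n.+1 * 'I_n.+1)) :
  tree (underlying T) -> t =i T -> rinc t \in unitmx.
Proof.
move=> [conn _] tT.
pose node (v : 'I_n.+1) : 'cV[int]_n := \col_r (v == lift ord0 r)%:R.
pose spanned v := exists z : 'cV[int]_n, rinc t *m z = node v.
have arcE a : arc_vec a = node a.1 - node a.2.
  by apply/matrixP => r c; rewrite !mxE.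
have arc_col a : a \in T -> exists z : 'cV[int]_n, rinc t *m z = arc_vec a.
  rewrite -tT => /tnthP[c ->]; exists (delta_mx c ord0).
  by rewrite -colE; apply/matrixP => r s; rewrite !mxE.
have step u v : underlying T u v -> spanned u -> spanned v.
  move=> /orP[] /arc_col[z zE] [y yE].
    by exists (y - z); rewrite mulmxBr yE zE arcE subKr.
  by exists (y + z); rewrite mulmxDr yE zE arcE addrC subrK.
have all_spanned v : spanned v.
  have /connectP[p] := conn ord0 v.
  have : spanned ord0.
    by exists 0; rewrite mulmx0; apply/matrixP => r c; rewrite !mxE.
  elim: p (ord0 : 'I_n.+1) => [|u p IH] x sx /=; first by move=> _ ->.
  by move=> /andP[/step /(_ sx) su]; exact: IH.
have /fin_all_exists[Z ZE] (r : 'I_n) := all_spanned (lift ord0 r).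
suff /mulmx1_unit[] : rinc t *m (\matrix_(i, r) Z r i ord0) = 1%:M by [].
apply/matrixP => r s; have /matrixP /(_ r ord0) := ZE s.
rewrite !mxE (inj_eq lift_inj) eq_sym => <-.
by apply: eq_bigr => i _; rewrite !mxE.
Qed.

(** * Orientations of the cycle *)

Section OrientedCycle.
Variables (n : nat) (H : {set 'I_n.+1 * 'I_n.+1}).
Hypothesis hN : (2 < n.+1)%N.
Hypothesis oH : orientation (@cycle_adj n) H.

(** The arc of the orientation on the edge between i and its successor. *)
Definition edge_arc (i : 'I_n.+1) : 'I_n.+1 * 'I_n.+1 :=
  if (i, ordS i) \in H then (i, ordS i) else (ordS i, i).

(** Whether an arc of the cycle points clockwise (1) or not (-1). *)
Definition arc_sign (a : 'I_n.+1 * 'I_n.+1) : int :=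
  if a.2 == ordS a.1 then 1 else -1.

Lemma arc_sign_edge i :
  arc_sign (edge_arc i) = if (i, ordS i) \in H then 1 else -1.
Proof.
rewrite /edge_arc; case: ifP => _; rewrite /arc_sign /= ?eqxx //.
by rewrite -/(ordS (ordS i)) eq_sym (negbTE (ordSS_neq i hN)).
Qed.

Lemma edge_arc_inj : injective edge_arc.
Proof.
move=> i j; rewrite /edge_arc; case: ifP => _; case: ifP => _ [] // e1 e2.
  by have := ordSS_neq j hN; rewrite -[ordS j]e1 e2 eqxx.
by have := ordSS_neq j hN; rewrite -[ordS j]e2 e1 eqxx.
Qed.

Lemma rev_arc i : ((ordS i, i) \in H) = ((i, ordS i) \notin H).
Proof. by have := oH.2 _ _ (cycle_adjS i); do 2!case: (_ \in H). Qed.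

Lemma edge_arc_in i : edge_arc i \in H.
Proof. by rewrite /edge_arc; case: ifP => // /negbT; rewrite -rev_arc. Qed.

Lemma orientationE : H = [set edge_arc i | i in 'I_n.+1]%SET.
Proof.
apply/setP => -[x y]; apply/idP/imsetP => [xyH|[i _ ->]];
    last exact: edge_arc_in.
have /orP[/eqP e|/eqP e] := oH.1 _ _ xyH.
  by exists x; rewrite ?inE // /edge_arc -e xyH.
exists y; rewrite ?inE // /edge_arc -e ifN //.
by rewrite e -rev_arc -e.
Qed.

Lemma card_orientation : #|H| = n.+1.
Proof.
rewrite orientationE card_imset; first by rewrite card_ord.
exact: edge_arc_inj.
Qed.

(** The arcs of an orientation, signed by their direction, sum to zero. *)
Lemma arc_vec_cycle_sum (r : 'I_n) :
  \sum_(c in H) arc_sign c * arc_vec c r ord0 = 0.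
Proof.
rewrite orientationE big_imset /=; last by move=> i j _ _; exact: edge_arc_inj.
pose f (i : 'I_n.+1) : int := (i == lift ord0 r)%:R.
transitivity (\sum_i (f i - f (ordS i))).
  apply: eq_big => // i _; rewrite arc_sign_edge mxE.
  rewrite /edge_arc; case: ifP => _ /=; first by rewrite mul1r.
  by rewrite mulN1r opprB.
rewrite sumrB (reindex_inj (@ordS_inj n.+1)) /= subrr //.
Qed.

Lemma balanced_card_clockwise :
  #|[set a in H | a.2 == ordS a.1]%SET| = #|[set a in H | a.1 == ordS a.2]%SET| ->
  (#|[set i | (i, ordS i) \in H]%SET|.*2 = n.+1)%N.
Proof.
move=> bal; pose D := [set i | (i, ordS i) \in H]%SET.
have cw : [set a in H | a.2 == ordS a.1] = [set (i, ordS i) | i in D]%SET.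
  apply/setP => -[x y]; rewrite !inE /=; apply/andP/imsetP.
    by move=> [xyH /eqP e]; exists x; rewrite ?inE -e.
  by move=> [j]; rewrite inE => jD [-> ->].
have ccw : [set a in H | a.1 == ordS a.2] = [set (ordS i, i) | i in ~: D]%SET.
  apply/setP => -[x y]; rewrite !inE /=; apply/andP/imsetP.
    by move=> [xyH /eqP e]; exists y; rewrite ?inE -?rev_arc -e.
  by move=> [j]; rewrite !inE -rev_arc => jD [-> ->].
rewrite cw ccw !card_imset in bal; try by move=> i j [].
by rewrite -addnn {2}bal cardsC card_ord.
Qed.

(** Solving the vanishing signed sum of the arcs for the arc a missing from the
    tree expresses it in the basis of the tree arcs, which is what tau does. *)
Lemma tau_sign (T : {set 'I_n.+1 * 'I_n.+1})
    (t : n.-tuple ('I_n.+1 * 'I_n.+1)) a c :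
  uniq t -> t =i T -> rinc t \in unitmx -> a \in H -> T = H :\ a ->
  tau t a ord0 c = - (arc_sign a * arc_sign (tnth t c)).
Proof.
move=> ut tT unit_t aH TE.
pose z : 'cV[int]_n := \col_c - (arc_sign a * arc_sign (tnth t c)).
suff zE : rinc t *m z = arc_vec a by rewrite /tau -zE mulKmx // !mxE.
apply/colP => r; rewrite mxE.
transitivity (- arc_sign a * \sum_(b in T) arc_sign b * arc_vec b r ord0).
  rewrite -(eq_bigl _ _ tT) -big_uniq // big_tuple mulr_sumr.
  by apply: eq_bigr => b _; rewrite !mxE; ring.
have := arc_vec_cycle_sum r; rewrite (big_setD1 a) //= -TE => /eqP.
rewrite addrC addr_eq0 => /eqP ->; rewrite mulrNN mulrA.
by rewrite /arc_sign; case: ifP => _; rewrite ?mulrNN !mul1r.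
Qed.

End OrientedCycle.

(** * Tree solutions *)

Section TreeSolution.
Variables (R : realType) (n : nat) (k : R[i]) (K : 'M[R[i]]_n.+1).
Variables (H T : {set 'I_n.+1 * 'I_n.+1}).
Variables (t : n.-tuple ('I_n.+1 * 'I_n.+1)) (a : 'I_n.+1 * 'I_n.+1).
Variable (z : R[i]).
Hypotheses (hN : (2 < n.+1)%N) (k0 : k != 0) (hK : sign_choice k K).
Hypothesis hpar : parity_condition n (num_negative k K).
Hypotheses (oH : balanced_orientation H) (hT : weak_spanning_tree H T).
Hypotheses (ut : uniq t) (tT : t =i T) (aHT : a \in H :\: T) (z0 : z != 0).

Let aH : a \in H. Proof. by case/setDP: aHT. Qed.

(** By counting: H has n + 1 arcs and the list t of the arcs of T has n. *)
Lemma weak_tree_complement : T = H :\ a.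
Proof.
case/setDP: aHT => _ aT; have [TH _] := hT.
apply/eqP; rewrite eqEcard; apply/andP; split.
  apply/fintype.subsetP => c cT; rewrite !inE (fintype.subsetP TH) // andbT.
  by apply: contraNneq aT => <-.
have := cardsD1 a H; rewrite aH (card_orientation _ _ hN oH.1) add1n => -[<-].
by rewrite -(eq_card tT) (card_uniqP ut) size_tuple.
Qed.

Let unit_t : rinc t \in unitmx.
Proof. exact: rinc_unitmx hT.2 tT. Qed.

Let b : R[i] := k / (2%:R * 'i%C).

Let b0 : b != 0.
Proof. by rewrite mulf_neq0 ?invr_eq0 ?imaginary2_neq0. Qed.

Lemma acoef_sign i : acoef K i (ordS i) = (-1) ^+ (K i (ordS i) == - k) * b.
Proof. by rewrite /acoef {1}(sign_choiceE _ _ _ _ i hK) mulrA. Qed.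

Let acoef_neq0 i : acoef K i (ordS i) != 0.
Proof. by rewrite acoef_sign mulf_neq0 ?signr_eq0. Qed.

Let acoef_sym i : acoef K (ordS i) i = acoef K i (ordS i).
Proof. by rewrite /acoef (hK _ _ (cycle_adjS i)).1. Qed.

Lemma acoef_sqr i : acoef K i (ordS i) ^+ 2 = b ^+ 2.
Proof. by rewrite acoef_sign exprMn sqrr_sign mul1r. Qed.

Let x := tree_solution K t a z.
Let X := with_root 1 x.

Let arc_sign_neq0 c : (arc_sign n c)%:~R != 0 :> R[i].
Proof. by rewrite intr_eq0 /arc_sign; case: ifP. Qed.

Let acoef_arc_neq0 c : c \in H -> acoef K c.1 c.2 != 0.
Proof.
rewrite (orientationE _ _ oH.1) => /imsetP[i _ ->]; rewrite /edge_arc.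
by case: ifP => _ /=; rewrite -?/(ordS i) ?acoef_sym acoef_neq0.
Qed.

Let tree_arc c : tnth t c \in H.
Proof. by have := mem_tnth c t; rewrite tT; exact: (fintype.subsetP hT.1). Qed.

Let tauE c :
  tau t a ord0 c = - (arc_sign n a * arc_sign n (tnth t c)).
Proof. exact: (tau_sign _ _ hN oH.1 _ _ _ _ ut tT unit_t aH weak_tree_complement). Qed.

Let y_torus : torus (\row_c (z * (tau t a ord0 c)%:~R *
  (acoef K (tnth t c).1 (tnth t c).2)^-1)).
Proof.
move=> c; rewrite mxE !mulf_neq0 ?invr_eq0 ?acoef_arc_neq0 //.
by rewrite tauE intrN oppr_eq0 intrM mulf_neq0 ?arc_sign_neq0.
Qed.

Lemma tree_solution_torus : torus x.
Proof. exact: mx_power_torus. Qed.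

Let X_neq0 i : X i != 0.
Proof.
rewrite /X; case: (unliftP ord0 i) => [j ->|->]; rewrite ?with_root_lift ?with_root0.
  exact: tree_solution_torus.
exact: oner_neq0.
Qed.

(** The equations that characterize the tree solution. *)
Lemma tree_solution_arc c :
  acoef K (tnth t c).1 (tnth t c).2 * (X (tnth t c).1 / X (tnth t c).2) =
  z * (tau t a ord0 c)%:~R.
Proof.
rewrite -arc_monomial; last exact: tree_solution_torus.
have -> : \prod_r x ord0 r ^ arc_vec (tnth t c) r ord0 =
    mx_power x (rinc t) ord0 c.
  by rewrite [RHS]mxE; apply: eq_bigr => r _; congr (_ ^ _); rewrite [RHS]mxE.
rewrite /x /tree_solution (mx_powerM _ _ _ _ _ y_torus) (mulVmx unit_t).
by rewrite mx_power1 mxE mulrC mulfVK ?acoef_arc_neq0.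
Qed.

(* the value on the clockwise arcs c of the tree, where tau_c is minus the sign
   of a *)
Let mu : R[i] := - (z * (arc_sign n a)%:~R).

Let mu0 : mu != 0.
Proof. by rewrite oppr_eq0 mulf_neq0 ?arc_sign_neq0. Qed.

(* the value on the edge between i and its successor, read clockwise *)
Let value i := acoef K i (ordS i) * (X i / X (ordS i)).

Let expected (i : 'I_n.+1) : R[i] :=
  if (i, ordS i) \in H then mu else - (b ^+ 2 / mu).

Let expected_neq0 i : expected i != 0.
Proof.
rewrite /expected; case: ifP => _ //.
by rewrite oppr_eq0 mulf_neq0 ?invr_eq0 ?expf_neq0.
Qed.

Let value_tree i : edge_arc n H i != a -> value i = expected i.
Proof.
move=> ia.
have /tnthP[c cE] : edge_arc n H i \in t.
  rewrite tT weak_tree_complement !inE ia.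
  exact: edge_arc_in oH.1 _.
have := tree_solution_arc c; rewrite tauE -cE (arc_sign_edge _ _ hN) /value /expected.
rewrite /edge_arc; case: ifP => _ /=; rewrite -?/(ordS i).
  by move=> ->; rewrite mulr1 intrN mulrN.
rewrite acoef_sym mulrN1 opprK => e.
rewrite -(acoef_sqr i) /mu -e; field.
by rewrite !X_neq0 acoef_neq0.
Qed.

(* Around the cycle the ratios of X multiply to 1, while the parity condition
   makes the expected values multiply to the product of the coefficients. *)
Let value_prod : \prod_i value i = \prod_i expected i.
Proof.
have hD := balanced_card_clockwise _ _ oH.1 oH.2.
set D := [set i | _]%SET in hD.
have -> : \prod_i value i = \prod_i acoef K i (ordS i).
  rewrite /value big_split /=.
  have -> : \prod_i (X i / X (ordS i)) = 1; last by rewrite mulr1.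
  rewrite big_split /= prodfV [X in X / _](reindex_inj (@ordS_inj n.+1)) /=
    divff //.
  by apply/prodf_neq0.
rewrite (eq_bigr _ (fun i _ => acoef_sign i)) big_split /= prodr_const card_ord.
have -> : b ^+ n.+1 = (b ^+ 2) ^+ #|D| by rewrite -exprM mul2n hD.
have -> : \prod_i (-1) ^+ (K i (ordS i) == - k) = (-1) ^+ num_negative k K :> R[i].
  by rewrite (prodr_sign _ _ (fun i => K i (ordS i) == - k)) num_negativeE.
have -> : (-1) ^+ num_negative k K = (-1) ^+ #|D| :> R[i].
  have [h0 h2] := hpar; rewrite -signr_odd -[RHS]signr_odd; congr (_ ^+ _).
  have [e|e] : (n.+1 %% 4 = 0 \/ n.+1 %% 4 = 2)%N by lia.
    by have := h0 e; lia.
  by have := h2 e; lia.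
rewrite [RHS](bigID (mem D)) /=.
rewrite (eq_bigr (fun=> mu)); last by move=> i; rewrite inE /expected => ->.
rewrite [X in _ = _ * X](eq_bigr (fun=> - (b ^+ 2 / mu))); last first.
  by move=> i; rewrite inE /expected => /negbTE ->.
rewrite !prodr_const (_ : #|[predC D]| = #|D|); last first.
  by apply/eqP; rewrite -(eqn_add2l #|D|) cardC card_ord addnn hD.
by rewrite -!exprMn; congr (_ ^+ _); field; rewrite mu0.
Qed.

Let value_all i : value i = expected i.
Proof.
have [j ja] : exists j, edge_arc n H j = a.
  by move: aH; rewrite {1}(orientationE _ _ oH.1) => /imsetP[j _ ->]; exists j.
have [|ia] := eqVneq (edge_arc n H i) a; last exact: value_tree.
rewrite -ja => /(edge_arc_inj _ _ hN) ->.
have := value_prod; rewrite (bigD1 j) //= [in RHS](bigD1 j) //=.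
rewrite [X in _ * X](eq_bigr expected); first apply: mulIf.
  by apply/prodf_neq0.
move=> l lj; apply: value_tree; rewrite -ja.
by rewrite (inj_eq (edge_arc_inj _ _ hN)).
Qed.

Lemma tree_solution_zero : alg_zeros (@cycle_adj n) K 0 x.
Proof.
apply: (@alg_zeros_of_flow _ _ hN _ _ _ (mu - b ^+ 2 / mu)).
- exact: wbar0.
- by move=> i j /hK[].
- exact: tree_solution_torus.
move=> i; rewrite -/X.
have -> : acoef K i (ordS i) * (X i / X (ordS i) - X (ordS i) / X i) =
    value i - acoef K i (ordS i) ^+ 2 / value i.
  by rewrite /value; field; rewrite !X_neq0 acoef_neq0.
rewrite acoef_sqr value_all /expected; case: ifP => _ //.
by field; rewrite mu0 b0.
Qed.

End TreeSolution.

Theorem proposition5p3 (R : realType) (n : nat)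
    (hN : (2 < n.+1)%N) (hev : ~~ odd n.+1) :
  [/\ exists K : 'M[R[i]]_n.+1, coupling (@cycle_adj n) K /\
        forall w : R[i],
          infinite_set (alg_zeros (@cycle_adj n) K (const_mx w)),
      forall (k : R[i]) (K : 'M[R[i]]_n.+1),
        k != 0 -> sign_choice k K -> parity_condition n (num_negative k K) ->
        krull_dim_ge (alg_zeros (@cycle_adj n) K 0) 1 /\
        forall (H T : {set 'I_n.+1 * 'I_n.+1}) (t : n.-tuple ('I_n.+1 * 'I_n.+1))
               (a : 'I_n.+1 * 'I_n.+1),
          balanced_orientation H -> weak_spanning_tree H T ->
          uniq t -> t =i T -> a \in H :\: T ->
          [set tree_solution K t a lambda | lambda in [set l : R[i] | l != 0]]
            `<=` alg_zeros (@cycle_adj n) K 0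
    & forall (k : R) (K : 'M[R]_n.+1),
        k != 0 -> sign_choice k K -> parity_condition n (num_negative k K) ->
        real_dim_ge (trans_zeros (@cycle_adj n) K 0) 1].
Proof.
have n0 : (0 < n)%N by lia.
split.
- (* one negative edge {0, 1} when it is required, none otherwise *)
  pose K : 'M[R[i]]_n.+1 :=
    \matrix_(i, j) if (n.+1 %% 4 == 2)%N && (i + j == 1)%N then - 1 else 1.
  have hK : sign_choice 1 K.
    by move=> i j _; rewrite !mxE addnC; case: ifP => _; split=> //; [right|left].
  have neg1 : (-1 == 1 :> R[i]) = false.
    by apply/negbTE; rewrite -subr_eq0 -opprD oppr_eq0 (pnatr_eq0 _ 2).
  have hpar : parity_condition n (num_negative 1 K).
    have -> : num_negative 1 K = (n.+1 %% 4 == 2)%N.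
      rewrite num_negativeE //; case: (boolP (n.+1 %% 4 == 2)%N) => e.
        rewrite (@fintype.eq_card1 _ (ord0 : 'I_n.+1)) // => i.
        rewrite !inE mxE e val_ordS -(inj_eq val_inj) /=.
        have -> : (i + (if i == n :> nat then 0 else i.+1) == 1)%N = (i == 0 :> nat)%N.
          by case: (nat_of_ord i =P n); lia.
        by case: (nat_of_ord i == 0)%N; rewrite ?eqxx // eq_sym neg1.
      apply: fintype.eq_card0 => i.
      by rewrite !inE mxE (negbTE e) /= eq_sym neg1.
    by split=> e; rewrite e.
  exists K; split=> [i j|w].
    move=> /hK[-> h]; split=> //.
    by case: h => ->; rewrite ?oppr_eq0 oner_neq0.
  rewrite num_negativeE // in hpar.
  have [m [m0 mS]] := sign_potential _ _ hev hpar.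
  apply: (alternating_infinite _ _ m _ n0) => z z0.
  by apply: (alternating_alg_zero _ _ hN 1) => // i; exact: wbar_const.
- move=> k K k0 hK hpar; split.
    rewrite num_negativeE // in hpar.
    have [m [m0 mS]] := sign_potential _ _ hev hpar.
    apply: (alternating_krull_dim _ _ m _ n0) => z z0.
    by apply: (alternating_alg_zero _ _ hN k) => // i; exact: wbar0.
  move=> H T t a oH hT ut tT aHT _ [z z0 <-].
  exact: (tree_solution_zero R n k K H T t a z).
- move=> k K k0 hK hpar; rewrite num_negativeE // in hpar.
  have [m [m0 mS]] := sign_potential _ _ hev hpar.
  pose c : 'rV[R]_n := \row_j (pi *+ m (lift ord0 j)).
  pose w : 'rV[R]_n := \row_j (odd (lift ord0 j))%:R.
  apply: (real_dim_line _ _ _ c w).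
    apply/eqP => /rowP /(_ (Ordinal n0)); rewrite !mxE /= => /eqP.
    by rewrite oner_eq0.
  move=> x; have := alternating_trans_zero R n k K 0 m (x ord0 ord0)
    hN hev hK (wbar0 _ _) m0 mS.
  congr (trans_zeros _ _ _ _); apply/rowP => j.
  by rewrite !mxE addrC mulr_natr.
Qed.
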